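(* Let $d$ and $k$ be fixed integers with $d\geq 2k\geq 6$, and let $r=\lfloor d/2\rfloor$. Then, as $n\to\infty$, \[S^k_{d}(n)=\binom{r}{k}\left(\frac{n}{r}\right)^k+o(n^k).\]
   Context: For an integer $k\geq 3$, a regular $(k-1)$-simplex is a set of $k$ points (vertices) in Euclidean space that are pairwise equidistant, i.e. all pairwise distances are equal. A point set spans a regular $(k-1)$-simplex if all $k$ of its vertices belong to the point set. $S^k_d(n)$ denotes the maximum number of regular $(k-1)$-simplices spanned by a set of $n$ points in $\mathbb{R}^d$ (the maximum is over all sets of $n$ points; simplices of all side lengths are counted). *)

(* Defs.v *)
From HB Require Import structures.
From mathcomp Require Import all_boot all_order all_algebra finmap.
From mathcomp Require Import all_classical all_reals all_analysis.
Set Implicit Arguments.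
Unset Strict Implicit.
Unset Printing Implicit Defensive.
Import Order.TTheory GRing.Theory Num.Theory.
Import numFieldNormedType.Exports.
Local Open Scope fset_scope.
Local Open Scope ring_scope.

(* The norm that the library puts on row vectors is the maximum norm, hence
   this definition. *)
Definition edist (R : realType) (d : nat) (x y : 'rV[R]_d) : R :=
  Num.sqrt (\sum_(i < d) (x 0 i - y 0 i) ^+ 2).

Definition regular_simplex (R : realType) (d k : nat) (A : {fset 'rV[R]_d}) :
    Prop :=
  #|` A| = k /\
  exists l : R, forall x y, x \in A -> y \in A -> x != y -> edist x y = l.

Definition nsimplices (R : realType) (d k : nat) (P : {fset 'rV[R]_d}) : nat :=
  #|` [fset A in fpowerset P | `[< regular_simplex k A >]]|.

(* [2 ^ n] only serves to make the range of the maximum finite: it bounds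
   [nsimplices k P] for every set [P] of [n] points. That this really is the
   maximum is [nsimplices_le_max] and [max_nsimplices_attained]. *)
Definition max_nsimplices (R : realType) (d k n : nat) : nat :=
  \max_(m < (2 ^ n).+1 |
    `[< exists P : {fset 'rV[R]_d}, #|` P| = n /\ nsimplices k P = m >]) m.

Lemma nsimplices_le (R : realType) (d k : nat) (P : {fset 'rV[R]_d}) :
  (nsimplices k P <= 2 ^ #|` P|)%N.
Proof.
rewrite -card_fpowerset; apply: fsubset_leq_card.
by apply/fsubsetP => A; rewrite !inE /= => /andP[].
Qed.

Lemma nsimplices_le_max (R : realType) (d k : nat) (P : {fset 'rV[R]_d}) :
  (nsimplices k P <= max_nsimplices R d k #|` P|)%N.
Proof.
have lt_m : (nsimplices k P < (2 ^ #|` P|).+1)%N by rewrite ltnS nsimplices_le.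
apply: (@leq_bigmax_cond _ _ (fun m : 'I__ => m : nat) (Ordinal lt_m)).
by apply/asboolP; exists P.
Qed.

Lemma max_nsimplices_attained (R : realType) (d k n : nat) : (0 < d)%N ->
  exists P : {fset 'rV[R]_d},
    #|` P| = n /\ nsimplices k P = max_nsimplices R d k n.
Proof.
case: d => // d _.
pose f (i : nat) : 'rV[R]_d.+1 := const_mx i%:R.
have f_inj : injective f.
  move=> i j /matrixP/(_ 0 0); rewrite !mxE => /eqP.
  by rewrite eqr_nat => /eqP.
pose P0 : {fset 'rV[R]_d.+1} := [fset x in map f (iota 0 n)].
have cP0 : #|` P0| = n.
  rewrite card_fseq undup_id ?size_map ?size_iota //.
  by rewrite map_inj_uniq // iota_uniq.
have lt_m : (nsimplices k P0 < (2 ^ n).+1)%N.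
  by rewrite ltnS -[in leqRHS]cP0 nsimplices_le.
rewrite /max_nsimplices (bigop.bigmax_eq_arg (Ordinal lt_m)); last first.
  by apply/asboolP; exists P0.
case: arg_maxnP; first by apply/asboolP; exists P0.
by move=> m /asboolP[P [cP nP]] _; exists P.
Qed.

(* Main.v *)
Require Import Defs.
From mathcomp Require Import all_boot all_order all_algebra finmap.
From mathcomp Require Import all_classical all_reals all_analysis.
From mathcomp Require Import zify ring lra.
Import Order.TTheory GRing.Theory Num.Theory.
Import numFieldNormedType.Exports.

(** Lower bound. In R^d with r = floor (d / 2) there are r mutually orthogonal
    planes; on the unit circle of each of them put about n / r points. Points on
    distinct circles are at distance sqrt 2, so choosing k circles and a point
    on each gives a regular simplex: this makes C(r, k) (n / r)^k of them
    ([max_nsimplices_ge]).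

    Upper bound. Colour each pair of points by its distance; the simplices are
    the monochromatic k-sets. If two sets of points are such that all distances
    between them are equal, the directions inside the first are orthogonal to
    those inside the second, and three points equidistant from a fourth are not
    collinear. Hence r + 1 triples with a constant distance between any two of
    them would span r + 1 mutually orthogonal planes, which needs dimension
    2 (r + 1) > d ([no_equidistant_triples]). It is essential that the constant
    may depend on the pair of triples: this is what controls simplices of all
    side lengths together rather than one side length at a time.

    The rest is combinatorics of colourings of pairs without such a pattern
    ([card_mono_cliques_le]). Call a colour popular if a positive proportion of
    the pairs has it. A monochromatic set of an unpopular colour has three
    vertices x, y, z such that z is confined by x and y to a small proportion of
    the points, so that there are few such sets as soon as k >= 3
    ([card_mono_unpopular]). The pairs of popular colours form one graph whose
    edges carry boundedly many colours. If it had a positive density of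
    (r + 1)-cliques, the pigeonhole principle on colour patterns and the
    theorem of Erdos on complete multipartite hypergraphs would give r + 1
    triples with a constant colour between any two ([coloured_box]). So it has
    few (r + 1)-cliques, and the Moon-Moser inequalities propagate this down to
    the bound C(r, k) (n / r)^k + o(n^k) for its k-cliques
    ([Zykov_stability]). *)

Set Implicit Arguments.
Unset Strict Implicit.
Unset Printing Implicit Defensive.

Local Open Scope ring_scope.

(* The extended distance of pseudometric spaces has the same name. *)
Local Notation edist := Defs.edist.

(** * Clique counts in graphs with few larger cliques *)

Section Cliques.
Variables (T : finType) (e : rel T).
Definition clique (A : {set T}) :=
  [forall x in A, forall y in A, (x != y) ==> e x y].
Definition cliques s := [set A : {set T} | clique A & #|A| == s].
Definition extends (A : {set T}) v := (v \notin A) && clique (v |: A).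
Definition codeg (A : {set T}) := #|[set v | extends A v]|.

Lemma cliqueP (A : {set T}) :
  reflect {in A &, forall x y, x != y -> e x y} (clique A).
Proof.
apply: (iffP forall_inP) => [h x y xA yA xy|h x xA].
  by have /forall_inP/(_ y yA)/implyP := h x xA; apply.
by apply/forall_inP => y yA; apply/implyP; exact: h.
Qed.

Lemma cliqueS (A B : {set T}) : A \subset B -> clique B -> clique A.
Proof.
move=> /fintype.subsetP sAB /cliqueP h; apply/cliqueP => x y xA yA.
by apply: h; apply: sAB.
Qed.

(** Double counting of the pairs (A, a) with a in A: removing a turns them into
    pairs made of a smaller clique and a vertex that extends it. *)
Lemma sum_flags (F : {set T} -> nat) s :
  (\sum_(A in cliques s.+1) \sum_(a in A) F (A :\ a) =
   \sum_(B in cliques s) F B * codeg B)%N.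
Proof.
under [RHS]eq_bigr => B _ do
  rewrite /codeg -sum1_card big_distrr /= muln1.
rewrite (exchange_big_dep predT) //= [RHS](exchange_big_dep predT) //=.
apply: eq_bigr => a _.
rewrite (reindex_onto (fun B => a |: B) (fun A => A :\ a)) /=; last first.
  by move=> A /andP[_ aA]; rewrite finset.setD1K.
apply: eq_big => [B|B /andP[_ /eqP ->] //].
rewrite !inE /extends.
have [aB|aB] := boolP (a \in B).
  rewrite /= !andbF; apply/negbTE/nandP; right.
  by apply: contraTneq aB => <-; rewrite !inE eqxx.
rewrite eqxx finset.setU1K // eqxx !andbT cardsU1 aB /= add1n eqSS.
have [cl|] := boolP (clique (a |: B)); last by rewrite !andbF.
by rewrite (cliqueS _ cl) ?finset.subsetUr //= andbT.
Qed.

Lemma sum_codeg s : (\sum_(B in cliques s) codeg B = s.+1 * #|cliques s.+1|)%N.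
Proof.
have := sum_flags (fun=> 1%N) s; under [RHS]eq_bigr do rewrite mul1n.
move=> <-; rewrite mulnC -sum_nat_const; apply: eq_bigr => A.
by rewrite inE sum1_card => /andP[_ /eqP].
Qed.

(** A vertex v that does not extend A extends at most one facet of A: two facets
    cover A, so extending both would make v adjacent to all of A. *)
Lemma sum_codeg_facets (A : {set T}) s : A \in cliques s.+1 ->
  (\sum_(a in A) codeg (A :\ a) <= s * codeg A + #|T|)%N.
Proof.
rewrite inE => /andP[/cliqueP clA /eqP cA].
under eq_bigr => a _ do rewrite /codeg -sum1_card big_mkcond.
rewrite exchange_big /= /codeg -[X in (_ * X)%N]sum1_card big_distrr /=.
rewrite [X in (X + _)%N]big_mkcond -sum1_card -big_split /=.
apply: leq_sum => v _; rewrite inE muln1 -big_mkcondr /= sum1dep_card.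
case: ifPn => [_|nv].
  rewrite addn1 -cA subset_leq_card //.
  by apply/fintype.subsetP => x; rewrite !inE => /andP[].
rewrite add0n; apply/card_le1_eqP => a b; rewrite !inE.
move=> /andP[aA /andP[va cla]] /andP[bA /andP[vb clb]].
apply/eqP; apply: contraNT nv => ab.
have vA : v \notin A.
  move: va vb; rewrite !inE !negb_and !negbK.
  by case: (v \in A) => //; rewrite !orbF => /eqP-> /eqP ba; rewrite ba eqxx in ab.
have ev x : x \in A -> e v x /\ e x v.
  move=> xA; have vx : v != x by apply: contraNneq vA => ->.
  have [c [cA' xc clc]] : exists c, [/\ c \in A, x != c & clique (v |: (A :\ c))].
    have [->|xa] := eqVneq x a; last by exists a.
    by exists b; rewrite eq_sym in ab.
  move/cliqueP: clc => clc.
  by split; apply: clc; rewrite ?inE ?eqxx ?xc ?xA ?orbT // eq_sym.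
rewrite /extends vA /=; apply/cliqueP => x y.
rewrite !inE => /orP[/eqP->|xA] /orP[/eqP->|yA]; rewrite ?eqxx //.
- by move=> _; case: (ev y yA).
- by move=> _; case: (ev x xA).
- exact: clA.
Qed.

(** The Moon-Moser inequality, without divisions: Cauchy-Schwarz for the
    codegrees of the s-cliques, whose squares sum to the codegrees of the facets
    of the (s+1)-cliques, bounded by [sum_codeg_facets]. *)
Lemma Moon_Moser s :
  ((s.+1 * #|cliques s.+1|) ^ 2 <=
   #|cliques s| * (s * s.+2 * #|cliques s.+2| + #|T| * #|cliques s.+1|))%N.
Proof.
have cs : ((\sum_(B in cliques s) codeg B) ^ 2 <=
    #|cliques s| * \sum_(B in cliques s) codeg B * codeg B)%N.
  rewrite -(leq_pmul2l (ltn0Sn 1)) -mulnn big_distrlr /=.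
  apply: (@leq_trans (\sum_(i in cliques s) \sum_(j in cliques s)
     (codeg i ^ 2 + codeg j ^ 2))%N).
    rewrite big_distrr /=; apply: leq_sum => i _; rewrite big_distrr /=.
    by apply: leq_sum => j _; exact: nat_Cauchy.
  under eq_bigr => i _ do rewrite big_split /= sum_nat_const.
  rewrite big_split /= -big_distrr /= sum_nat_const mul2n -addnn.
  by rewrite leq_add // leq_mul // leq_sum.
rewrite -sum_codeg (leq_trans cs) // leq_mul // -sum_flags.
apply: (@leq_trans (\sum_(A in cliques s.+1) (s * codeg A + #|T|))%N).
  by apply: leq_sum => A /sum_codeg_facets.
by rewrite big_split /= -big_distrr /= sum_codeg sum_nat_const mulnA [X in (_ + X)%N]mulnC.
Qed.

Lemma card_cliques_le s : (#|cliques s| <= 'C(#|T|, s))%N.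
Proof.
rewrite -cardsT -cards_draws; apply/subset_leq_card/fintype.subsetP => A.
by rewrite !inE finset.subsetT => /andP[].
Qed.
End Cliques.

Section Density.
Variables (R : realFieldType) (r : nat).
Hypothesis r_gt0 : (0 < r)%N.

(** Here [t s] stands for the density of ordered s-cliques; the fourth hypothesis
    is the Moon-Moser inequality for densities. Without (r+1)-cliques, the ratios
    [t s.+1 / t s] are at most [1 - s / r], with equality for the balanced
    complete r-partite graph. The excess [t s.+1 - (1 - s / r) * t s] measures
    how far this fails, and Moon-Moser bounds the square of the excess at s, if
    positive, by the excess at s+1. Starting from [eta ^+ (2 ^ r)] at r, repeated square roots
    leave at most [eta] at each s. *)
Lemma clique_density_stability (t : nat -> R) (eta : R) :
  0 <= eta <= 1 -> t 0%N = 1 -> (forall s, 0 <= t s <= 1) ->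
  (forall s, s.+1%:R * t s.+1 ^+ 2 <= t s * (s%:R * t s.+2 + t s.+1)) ->
  t r.+1 <= eta ^+ (2 ^ r) ->
  forall k, (k <= r)%N ->
  t k <= \prod_(i < k) (1 - i%:R / r%:R) + k%:R * eta.
Proof.
move=> /andP[eta0 eta1] t0 t01 mm tr.
have r0 : 0 < r%:R :> R by rewrite ltr0n.
have q01 i : (i <= r)%N -> 0 <= (1 - i%:R / r%:R : R) <= 1.
  move=> ir; rewrite lerBlDr lerDl divr_ge0 // andbT subr_ge0.
  by rewrite ler_pdivrMr // mul1r ler_nat.
(* Downward induction from s = r, as an induction on j = r - s. *)
have excess j : (j <= r)%N ->
    t (r - j).+1 - (1 - (r - j)%:R / r%:R) * t (r - j)%N <= eta ^+ (2 ^ (r - j)).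
  elim: j => [_|j IH jr]; first by rewrite subn0 divff ?gt_eqF // subrr mul0r subr0.
  have := IH (ltnW jr); rewrite -(subnSK jr); move: (r - j.+1)%N (leq_subr j.+1 r).
  move=> s sr {IH}; rewrite expnS mulnC exprM.
  move: (mm s) (t01 s) (t01 s.+1) (q01 s sr).
  set a := t s; set b := t s.+1; set c := t s.+2; set h := eta ^+ _.
  have h0 : 0 <= h by rewrite exprn_ge0.
  have s0 : 0 <= s%:R :> R by [].
  rewrite -natr1; set S := s%:R in s0 *.
  have -> : (1 - (S + 1) / r%:R) = (1 - S / r%:R) - 1 / r%:R by field; rewrite gt_eqF.
  have : S / r%:R = S * (1 / r%:R) by rewrite mulrA mulr1.
  set q := S / r%:R; set u := 1 / r%:R => qu mms /andP[a0 a1] /andP[b0 b1] /andP[q0 q1] hc.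
  rewrite leNgt; apply/negP => lth.
  (* With a, b, c the densities at s, s+1, s+2, this is Moon-Moser written in
     terms of the excesses at s and at s+1. *)
  have : (S + 1) * b * (b - (1 - q) * a) <= S * (c - (1 - q - u) * b) * a.
    rewrite qu in mms *; nra.
  have : h < b by nra.
  set x := b - _ in lth *; set y := c - _ in hc * => up hb.
  have low : h ^+ 2 < b * x by nra.
  have : S * y * a <= S * h ^+ 2.
    rewrite -mulrA ler_wpM2l //; nra.
  nra.
have excess' s : (s < r)%N -> t s.+1 <= (1 - s%:R / r%:R) * t s + eta.
  move=> sr; rewrite -lerBlDl -{1 2 3}(subKn (ltnW sr)).
  rewrite (le_trans (excess _ (leq_subr _ _))) //.
  rewrite -[leRHS]expr1; apply: ler_wiXn2l => //; exact: expn_gt0.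
elim=> [_|k IH kr]; first by rewrite big_ord0 t0 mul0r addr0.
rewrite (le_trans (excess' _ kr)) // big_ord_recr /= -natr1 [_ * eta]mulrDl mul1r addrA lerD2r.
have := IH (ltnW kr); have /andP[] := q01 k (ltnW kr).
have : 0 <= k%:R * eta by rewrite mulr_ge0.
move: (1 - _) (\prod_(_ < _) _) (t k) => q p x; nra.
Qed.
End Density.

(** The extremal number of k-cliques for graphs without (r+1)-cliques, in a form
    that tolerates a small proportion of (r+1)-cliques. *)
Lemma Zykov_stability (R : realFieldType) (T : finType) (e : rel T) (r k : nat) (eta : R) :
  (0 < #|T|)%N -> (0 < r)%N -> (k <= r)%N -> 0 <= eta <= 1 ->
  r.+1`!%:R * #|cliques e r.+1|%:R <= eta ^+ (2 ^ r) * #|T|%:R ^+ r.+1 ->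
  #|cliques e k|%:R <= 'C(r, k)%:R * (#|T|%:R / r%:R) ^+ k + k%:R * eta * #|T|%:R ^+ k.
Proof.
move=> n0 r0 kr eta01 few; set n : R := #|T|%:R in few *.
have nP : 0 < n by rewrite ltr0n.
have nXP s : 0 < n ^+ s by rewrite exprn_gt0.
have rP : 0 < r%:R :> R by rewrite ltr0n.
(* The proportion of the s-tuples of vertices that enumerate a clique. *)
pose t s := s`!%:R * #|cliques e s|%:R / n ^+ s.
have prodE : \prod_(i < k) (1 - i%:R / r%:R) = k`!%:R * 'C(r, k)%:R / r%:R ^+ k :> R.
  rewrite -natrM mulnC bin_ffact -[X in _ / _ ^+ X](card_ord k) -prodr_const.
  rewrite ffact_prod natr_prod -prodf_div.
  apply: eq_bigr => i _; rewrite natrB ?(leq_trans (ltnW (ltn_ord i))) //.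
  by field; rewrite gt_eqF.
have le1 s : t s <= 1.
  rewrite ler_pdivrMr // mul1r /n -natrX -natrM ler_nat mulnC.
  apply: (@leq_trans (#|T| ^_ s)); first by rewrite -bin_ffact leq_mul2r card_cliques_le orbT.
  rewrite ffact_prod -[X in (_ <= _ ^ X)%N](card_ord s) -prod_nat_const.
  by apply: leq_prod => i _; exact: leq_subr.
have := @clique_density_stability _ _ r0 t eta eta01 _ _ _ _ k kr.
have -> : t k = k`!%:R / n ^+ k * #|cliques e k|%:R by rewrite mulrAC.
move=> H; have {H} : k`!%:R / n ^+ k * #|cliques e k|%:R <=
   \prod_(i < k) (1 - i%:R / r%:R) + k%:R * eta.
  apply: H.
  - rewrite /t expr0 divr1 mul1r (_ : cliques e 0 = [set finset.set0]) ?cards1 //.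
    apply/setP => A; rewrite !inE cards_eq0 andbC.
    by case: eqP => // ->; apply/cliqueP => x y; rewrite inE.
  - by move=> s; rewrite le1 andbT divr_ge0 ?mulr_ge0 // ltW.
  - move=> s; have := Moon_Moser e s; rewrite -(ler_nat R) natrX !natrM natrD !natrM -/n.
    rewrite /t !factS !natrM !(exprS n).
    have := nXP s; set ns := n ^+ s => nsP.
    set x : R := #|cliques e s|%:R; set y : R := #|cliques e s.+1|%:R.
    set z : R := #|cliques e s.+2|%:R; set f := s`!%:R => H.
    rewrite -!natr1 in H *; set S : R := s%:R in H *.
    rewrite -subr_ge0.
    have -> : f * x / ns * (S * ((S + 1 + 1) * ((S + 1) * f) * z / (n * (n * ns))) +
       (S + 1) * f * y / (n * ns)) - (S + 1) * ((S + 1) * f * y / (n * ns)) ^+ 2 =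
       (S + 1) * (f / (n * ns)) ^+ 2 * (x * (S * (S + 1 + 1) * z + n * y) - ((S + 1) * y) ^+ 2).
      by field; rewrite !gt_eqF.
    rewrite mulr_ge0 ?subr_ge0 // mulr_ge0 ?addr_ge0 //.
    by rewrite exprn_ge0 // divr_ge0 // mulr_ge0 // ltW.
  - by rewrite ler_pdivrMr.
rewrite prodE => H.
have fP : 1 <= k`!%:R :> R by rewrite ler1n fact_gt0.
have -> : #|cliques e k|%:R = k`!%:R / n ^+ k * #|cliques e k|%:R * n ^+ k / k`!%:R :> R.
  by field; rewrite !gt_eqF // (lt_le_trans _ fP).
rewrite ler_pdivrMr ?(lt_le_trans _ fP) //.
apply: (@le_trans _ _ ((k`!%:R * 'C(r, k)%:R / r%:R ^+ k + k%:R * eta) * n ^+ k)).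
  by rewrite ler_wpM2r // ltW.
rewrite [leRHS]mulrC mulrDr mulrDl lerD //.
  by rewrite expr_div_n !mulrA [leRHS]mulrAC.
by rewrite ler_peMl // mulr_ge0 ?(ltW (nXP k)) // mulr_ge0 //; case/andP: eta01.
Qed.

(** * Complete multipartite patterns in dense sets of tuples *)

Lemma card_tuple_cons (T : finType) m (H : pred (seq T)) :
  #|[set t : m.+1.-tuple T | H t]| =
  (\sum_(t : m.-tuple T) #|[set v : T | H (v :: t)]|)%N.
Proof.
rewrite -sum1dep_card big_mkcond /=.
rewrite (reindex (fun p : T * m.-tuple T => [tuple of p.1 :: p.2])) /=; last first.
  exists (fun t : m.+1.-tuple T => (thead t, [tuple of behead t])) => [[v t] _|t _] /=.
    by congr pair; apply: val_inj.
  by rewrite [RHS]tuple_eta.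
rewrite -(pair_big xpredT xpredT (fun v (t : m.-tuple T) => if H (v :: t) then 1 else 0)%N) /=.
rewrite exchange_big /=; apply: eq_bigr => t _.
by rewrite -big_mkcond /= sum1dep_card.
Qed.

(** Erdos: a dense m-uniform relation on a large set contains a product of m sets
    of size q. Induction on m: on average over injective q-tuples [v] of first
    coordinates, the set of the tails that every entry of [v] completes is still
    dense, because a positive proportion of the tails has a linear number of
    completions. *)
Lemma box_in_dense_set (R : realType) (q m : nat) (delta : R) : 0 < delta ->
  exists N : nat, forall (T : finType) (H : pred (seq T)), (N <= #|T|)%N ->
  delta * #|T|%:R ^+ m <= #|[set t : m.-tuple T | H t]|%:R ->
  exists2 a : nat -> 'I_q -> T, forall i, (i < m)%N -> injective (a i) &
    forall c : nat -> 'I_q, H (mkseq (fun i => a i (c i)) m).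
Proof.
elim: m delta => [|m IH] delta d0.
  exists 1%N => T H n1 dH; have [x0] : exists x0 : T, x0 \in T by exact/card_gt0P.
  move=> _; exists (fun _ _ => x0) => // c.
  have : (0 < #|[set t : 0.-tuple T | H t]|)%N.
    by rewrite -(ltr0n R) (lt_le_trans _ dH) // expr0 mulr1.
  by case/card_gt0P => t; rewrite inE tuple0.
pose delta' := delta / 4 * (delta / 4) ^+ q.
have d'0 : 0 < delta' by rewrite mulr_gt0 ?exprn_gt0 ?divr_gt0.
have [N IHN] := IH _ d'0.
pose N' := Num.bound (4 * q%:R / delta).
exists (maxn 1 (maxn N N')) => T H; rewrite !geq_max => /and3P[n1 nN nN'].
set n : R := #|T|%:R => dH.
have nP : 0 < n by rewrite ltr0n.
have nq : q%:R <= delta / 4 * n.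
  have -> : q%:R = delta / 4 * (4 * q%:R / delta) by field; rewrite gt_eqF.
  rewrite ler_wpM2l ?divr_ge0 ?(ltW d0) // (@le_trans _ _ N'%:R) ?ler_nat //.
  by rewrite ltW // archi_boundP // divr_ge0 ?mulr_ge0 // ltW.
pose D (t : seq T) := [set v | H (v :: t)].
pose Hv (v : {ffun 'I_q -> T}) (s : seq T) := [forall j, H (v j :: s)].
have [/existsP[v /andP[/injectiveP vi vd]]|/existsPn none] :=
  boolP [exists v : {ffun 'I_q -> T}, injectiveb v &&
    (delta' * n ^+ m <= #|[set t : m.-tuple T | Hv v t]|%:R)].
  have [a ai aH] := IHN T (Hv v) nN vd.
  exists (fun i => if i is i'.+1 then a i' else fun j => v j) => [[|i]|c] //; first exact: ai.
  rewrite /mkseq /= (iotaDl 1 0) -map_comp.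
  by have /forallP := aH (fun i => c i.+1); apply.
exfalso; apply/negP: dH; rewrite -ltNge card_tuple_cons natr_sum.
have upper : (\sum_(t : m.-tuple T) #|D t| ^_ q)%:R <= delta' * n ^+ m * n ^+ q.
  have -> : (\sum_(t : m.-tuple T) #|D t| ^_ q =
      \sum_(v : {ffun 'I_q -> T} | injectiveb v) #|[set t : m.-tuple T | Hv v t]|)%N.
    under [RHS]eq_bigr => v _ do rewrite -sum1dep_card.
    rewrite (exchange_big_dep xpredT) //=; apply: eq_bigr => t _.
    rewrite sum1dep_card -[in LHS](card_ord q) -card_inj_ffuns_on.
    apply: eq_card => v; rewrite !inE andbC; congr (_ && _).
    by apply/ffun_onP/forallP => h j; have := h j; rewrite inE.
  rewrite natr_sum; apply: (@le_trans _ _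
      (\sum_(v : {ffun 'I_q -> T} | injectiveb v) delta' * n ^+ m)).
    by apply: ler_sum => v vi; have := none v; rewrite vi /= -ltNge => /ltW.
  rewrite sumr_const -mulr_natr.
  apply: ler_wpM2l; first by rewrite ltW // mulr_gt0 // exprn_gt0.
  rewrite /n -natrX ler_nat -[X in (_ <= _ ^ X)%N](card_ord q) -card_ffun.
  exact: max_card.
(* A linear upper bound for the degree of a tail in terms of the number of
   injective q-tuples of completions. *)
have tangent t : #|D t|%:R <= delta / 2 * n + n / (delta / 4 * n) ^+ q * (#|D t| ^_ q)%:R.
  have d4 : 0 < delta / 4 * n by rewrite mulr_gt0 // divr_gt0.
  have dn : #|D t|%:R <= n by rewrite ler_nat max_card.
  have [small|big] := leP #|D t|%:R (delta / 2 * n).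
    by apply: ler_wpDr => //; rewrite mulr_ge0 // divr_ge0 ?exprn_ge0 ?ltW.
  apply: ler_wpDl; first by rewrite mulr_ge0 ?divr_ge0 ?ltW.
  apply: (le_trans dn); rewrite -mulrA ler_peMr ?(ltW nP) //.
  rewrite mulrC ler_pdivlMr ?exprn_gt0 // mul1r.
  have qD : (q <= #|D t|)%N by rewrite -(ler_nat R); lra.
  apply: (@le_trans _ _ ((#|D t| - q) ^ q)%:R).
    by rewrite natrX natrB //; apply: lerXn2r; rewrite ?nnegrE ?subr_ge0 ?ler_nat ?(ltW d4) //; lra.
  rewrite ler_nat ffact_prod -[X in (_ ^ X <= _)%N](card_ord q) -prod_nat_const.
  by apply: leq_prod => i _; rewrite leq_sub2l // ltnW.
apply: (@le_lt_trans _ _ (\sum_(t : m.-tuple T)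
   (delta / 2 * n + n / (delta / 4 * n) ^+ q * (#|D t| ^_ q)%:R))).
  by apply: ler_sum => t _; exact: tangent.
rewrite big_split /= sumr_const card_tuple -[X in X + _]mulr_natr natrX -/n -mulr_sumr -natr_sum.
apply: (@le_lt_trans _ _ (delta / 2 * n * n ^+ m +
   n / (delta / 4 * n) ^+ q * (delta' * n ^+ m * n ^+ q))).
  rewrite lerD2l ler_wpM2l // ltW // divr_gt0 // exprn_gt0 // mulr_gt0 //.
  by rewrite divr_gt0.
have -> : n / (delta / 4 * n) ^+ q * (delta' * n ^+ m * n ^+ q) = delta / 4 * n ^+ m.+1.
  rewrite /delta' !exprMn exprS; field.
  by rewrite !expf_neq0 ?invr_neq0 ?(gt_eqF d0) ?(gt_eqF nP) // pnatr_eq0.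
have := exprn_gt0 m.+1 nP; rewrite exprS; nra.
Qed.

(** Each m-clique carries the pattern of the colours of its pairs; the number
    of patterns does not depend on T, so that one of them occurs on a positive
    proportion of the cliques, where [box_in_dense_set] applies. *)
Lemma coloured_box (R : realType) (q m M : nat) (delta : R) : 0 < delta ->
  exists N : nat, forall (T : finType) (e : rel T) (col : T -> T -> 'I_M),
  (N <= #|T|)%N -> delta * #|T|%:R ^+ m <= #|cliques e m|%:R ->
  exists2 a : nat -> 'I_q -> T, forall i, (i < m)%N -> injective (a i) &
    forall i j u v u' v', (i < j < m)%N -> e (a i u) (a j v) /\
      col (a i u) (a j v) = col (a i u') (a j v').
Proof.
move=> d0; pose Gamma := {ffun 'I_m * 'I_m -> 'I_M}.
pose delta' : R := delta / #|{: Gamma}|.+1%:R.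
have d'0 : 0 < delta' by rewrite divr_gt0.
have [N boxN] := @box_in_dense_set R q m _ d'0.
exists (maxn 1 N) => T e col; rewrite geq_max => /andP[n1 nN] dense.
have [x0 _] : exists x0 : T, x0 \in T by exact/card_gt0P.
pose vec (s : seq T) : Gamma := [ffun p : 'I_m * 'I_m => col (nth x0 s p.1) (nth x0 s p.2)].
pose H g s := pairwise e s && (vec s == g).
have [g gd] : exists g : Gamma, delta' * #|T|%:R ^+ m <= #|[set t : m.-tuple T | H g t]|%:R.
  apply/existsP; apply: contraT => /existsPn none.
  suff : #|cliques e m|%:R <= #|{: Gamma}|%:R * (delta' * #|T|%:R ^+ m).
    have nP : 0 < #|T|%:R ^+ m :> R by rewrite exprn_gt0 // ltr0n.
    have yP : 0 < delta' * #|T|%:R ^+ m by rewrite mulr_gt0.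
    have -> : #|{: Gamma}|%:R = #|{: Gamma}|.+1%:R - 1 :> R by rewrite -natr1 addrK.
    rewrite mulrBl mul1r mulrA [_.+1%:R * delta']mulrC divfK ?pnatr_eq0 //.
    by move=> /(le_trans dense); rewrite lerBrDr gerDl leNgt yP.
  apply: (@le_trans _ _ (\sum_(g : Gamma) #|[set t : m.-tuple T | H g t]|)%:R); last first.
    rewrite natr_sum mulr_natl -sumr_const; apply: ler_sum => g _.
    by have := none g; rewrite -ltNge => /ltW.
  rewrite ler_nat.
  have -> : (\sum_(g : Gamma) #|[set t : m.-tuple T | H g t]| =
     #|[set t : m.-tuple T | pairwise e t]|)%N.
    rewrite -sum1dep_card (partition_big (fun t : m.-tuple T => vec t) predT) //=.
    by apply: eq_bigr => g _; rewrite sum1dep_card.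
  pose f (A : {set T}) : m.-tuple T := insubd (nseq_tuple m x0) (enum A).
  have fE A : A \in cliques e m -> f A = enum A :> seq T.
    by rewrite inE => /andP[_ cA]; rewrite val_insubd /= -cardE cA.
  rewrite -(card_in_imset (f := f)); last first.
    move=> A B cA cB /(congr1 val) /=; rewrite !fE // => AB.
    by apply/setP => x; rewrite -mem_enum AB mem_enum.
  apply/subset_leq_card/fintype.subsetP => _ /imsetP[A cA ->]; rewrite inE fE //.
  apply/(pairwiseP x0) => i j; rewrite !inE => iA jA ij.
  move: cA; rewrite inE => /andP[/cliqueP clA _].
  have nthA l : (l < size (enum A))%N -> nth x0 (enum A) l \in A.
    by move=> lA; rewrite -mem_enum mem_nth.
  apply: clA; [exact: nthA|exact: nthA|].
  by rewrite nth_uniq ?enum_uniq // neq_ltn ij.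
(* Two coordinates of a point of the box can be chosen independently, which
   gives the edge and its colour, prescribed by the pattern g. *)
have [a ai aH] := boxN _ _ nN gd.
exists a => // i j u v u' v' /andP[ij jm].
have im := ltn_trans ij jm.
have step w z : e (a i w) (a j z) /\ col (a i w) (a j z) = g (Ordinal im, Ordinal jm).
  have /andP[/(pairwiseP x0) pw /eqP gE] := aH (fun l => if l == i then w else z).
  split.
    have := pw i j; rewrite !inE size_mkseq !nth_mkseq // eqxx (gtn_eqF ij).
    by apply.
  by rewrite -gE ffunE /= !nth_mkseq // eqxx (gtn_eqF ij).
by have [-> ->] := step u v; have [_ ->] := step u' v'.
Qed.

(** * Monochromatic cliques in edge-coloured complete graphs *)

(** Classes are indexed by numbers below [m] and not by an ordinal type, which
    spares casts in the induction of [box_in_dense_set]. *)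
Definition mono_multipartite (L T : Type) (c : T -> T -> L) m q (a : nat -> 'I_q -> T) :=
  (forall i, (i < m)%N -> injective (a i)) /\
  (forall i j u v u' v', (i < j < m)%N -> c (a i u) (a j v) = c (a i u') (a j v')).

(** A set in W is determined by an enumeration x, y, z, ... of its elements, and
    there are only [b] choices of z once x and y are known. *)
Lemma card_sets_by_third_vertex (T : finType) (k b : nat) (Q : T -> T -> pred T)
    (W : {set {set T}}) :
  (forall x y, #|[set z | Q x y z]| <= b)%N ->
  (forall A, A \in W -> #|A| = k.+3 /\ exists s : seq T,
     [/\ A =i s, size s = k.+3 &
      if s is x :: y :: z :: _ then Q x y z else false]) ->
  (#|W| <= b * #|T| ^ k.+2)%N.
Proof.
move=> Qb WQ.
pose D := [set p : T * T * T * k.-tuple T | Q p.1.1.1 p.1.1.2 p.1.2].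
pose f (p : T * T * T * k.-tuple T) := [set x in p.1.1.1 :: p.1.1.2 :: p.1.2 :: p.2].
apply: (@leq_trans #|f @: D|).
  apply/subset_leq_card/fintype.subsetP => A /WQ[_ [[|x [|y [|z s]]] [As // [] sk Qs]]].
  apply/imsetP; exists (x, y, z, Tuple (introT eqP sk)); first by rewrite inE.
  by apply/setP => w; rewrite As [RHS]inE.
apply: (leq_trans (leq_imset_card _ _)).
rewrite -sum1_card (eq_bigl (fun p : T * T * T * k.-tuple T =>
  Q p.1.1.1 p.1.1.2 p.1.2 && xpredT p.2)); last by move=> p; rewrite inE andbT.
rewrite -(pair_big (fun p : T * T * T => Q p.1.1 p.1.2 p.2) xpredT (fun _ _ => 1%N)) /=.
under eq_bigr do rewrite sum1_card card_tuple.
rewrite (eq_bigl (fun p : T * T * T => xpredT p.1 && Q p.1.1 p.1.2 p.2)) //.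
rewrite -(pair_big_dep xpredT (fun p : T * T => Q p.1 p.2) (fun _ _ => #|T| ^ k)%N) /=.
apply: (@leq_trans (\sum_(p : T * T) b * #|T| ^ k)%N).
  apply: leq_sum => p _; rewrite sum_nat_const leq_mul2r.
  by apply/orP; right; have := Qb p.1 p.2; rewrite cardsE.
by rewrite sum_nat_const card_prod !expnS mulnCA -!mulnA.
Qed.

Section MonochromaticCliques.
Variables (L : eqType) (T : finType) (c : T -> T -> L).
Definition mono (A : {set T}) := [forall x in A, forall y in A, forall z in A,
  forall w in A, (x != y) && (z != w) ==> (c x y == c z w)].
Definition mono_cliques k := [set A : {set T} | mono A & #|A| == k].

Lemma monoP (A : {set T}) :
  reflect {in A & &, forall x y z, {in A, forall w, x != y -> z != w -> c x y = c z w}}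
    (mono A).
Proof.
apply: (iffP forall_inP) => [h x y z xA yA zA w wA xy zw|h x xA].
  have /forall_inP/(_ y yA)/forall_inP/(_ z zA)/forall_inP/(_ w wA) := h x xA.
  by rewrite xy zw => /eqP.
apply/forall_inP => y yA; apply/forall_inP => z zA; apply/forall_inP => w wA.
by apply/implyP => /andP[xy zw]; apply/eqP; exact: h.
Qed.

Variables (R : realType) (eta : R).
Hypothesis eta0 : 0 < eta.
Definition popular l := eta ^+ 2 * #|T|%:R ^+ 2 <= #|[set p : T * T | c p.1 p.2 == l]|%:R.
Definition popular_graph x y := (x != y) && popular (c x y).

(** Call a vertex light for a colour if it has few neighbours of this colour.
    Take a monochromatic set of an unpopular colour l. If some vertex x of it is
    light, then x and any second vertex y determine l, and the third vertex is
    one of the few neighbours of x of colour l. Otherwise the third vertex is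
    one of the vertices that are not light for the colour l of the first two,
    and these are few because l is unpopular. *)
Lemma card_mono_unpopular k :
  #|[set A in mono_cliques k.+3 | ~~ clique popular_graph A]|%:R
    <= 2 * eta * #|T|%:R ^+ k.+3.
Proof.
pose n : R := #|T|%:R.
pose deg l x := #|[set y | c x y == l]|.
pose light l x := (deg l x)%:R <= eta * n.
pose Q x y z := (light (c x y) x && (c x z == c x y)) ||
  (~~ popular (c x y) && ~~ light (c x y) z).
pose b := (Num.truncn (eta * n)).
have bE s : s%:R <= eta * n -> (s <= b)%N.
  by move=> sn; rewrite truncn_ge_nat //; rewrite mulr_ge0 // ltW.
have bn : b%:R <= eta * n by rewrite truncn_le // mulr_ge0 // ltW.
apply: (@le_trans _ _ ((b + b) * #|T| ^ k.+2)%:R); last first.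
  rewrite natrM natrX natrD [_ ^+ k.+3]exprS mulrA ler_wpM2r ?exprn_ge0 // -/n.
  lra.
rewrite ler_nat; apply: (@card_sets_by_third_vertex _ _ _ Q) => [x y|A].
  apply: (@leq_trans (#|[set z | light (c x y) x && (c x z == c x y)]| +
      #|[set z | ~~ popular (c x y) && ~~ light (c x y) z]|)).
    rewrite -cardsUI; apply: (leq_trans _ (leq_addr _ _)).
    by apply/subset_leq_card/fintype.subsetP => z; rewrite !inE.
  apply: leq_add.
    have [lt|_] := boolP (light _ _); first exact: bE.
    by rewrite (_ : [set _ | _] = finset.set0) ?cards0 //; apply/setP => z; rewrite !inE.
  have [_|upop] := boolP (popular _).
    by rewrite (_ : [set _ | _] = finset.set0) ?cards0 //; apply/setP => z; rewrite !inE.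
  rewrite /=; set Z := [set z | _]; apply: bE.
  move: upop; rewrite -ltNge -/n; set l := c x y.
  rewrite -sum1dep_card (eq_bigl (fun p => xpredT p.1 && (c p.1 p.2 == l))) //.
  rewrite -(pair_big_dep xpredT (fun x y => c x y == l) (fun _ _ => 1%N)) /= natr_sum => upop.
  rewrite leNgt; apply/negP => ltZ; move: upop; apply/negP; rewrite -leNgt.
  apply: (@le_trans _ _ (\sum_(z in Z) eta * n)).
    rewrite sumr_const -mulr_natr -exprMn expr2 ler_wpM2l ?ltW //.
    rewrite mulr_gt0 // (@le_lt_trans _ _ (eta * n)) ?mulr_ge0 ?(ltW eta0) //.
    by rewrite (lt_le_trans ltZ) // ler_nat max_card.
  rewrite big_mkcond /=; apply: ler_sum => z _; rewrite sum1dep_card inE.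
  by case: ifPn => //; rewrite -ltNge => /ltW.
rewrite !inE => /andP[/andP[/monoP mA /eqP cA] ncl]; split => //.
have [x [y [xA yA xy upop]]] : exists x y, [/\ x \in A, y \in A, x != y & ~~ popular (c x y)].
  have [/existsP[x /existsP[y /and4P[*]]]|no] := boolP [exists x, exists y,
    [&& x \in A, y \in A, x != y & ~~ popular (c x y)]]; first by exists x, y.
  case/negP: ncl; apply/cliqueP => x y xA yA xy; rewrite /popular_graph xy /=.
  by move/existsPn/(_ x)/existsPn/(_ y): no; rewrite xA yA xy negbK.
have := cA; rewrite cardE; have := mem_enum A; have := enum_uniq A.
case: (enum A) => [|x1 [|x2 [|x3 s]]] //= /and4P[x1s x2s x3s us] sA [ss].
have [A1 A2 A3] : [/\ x1 \in A, x2 \in A & x3 \in A].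
  by rewrite -!sA !inE !eqxx !orbT.
move: x1s x2s; rewrite !inE !negb_or => /and3P[x12 x13 _] /andP[x23 _].
have lE u v : u \in A -> v \in A -> u != v -> c u v = c x y.
  by move=> uA vA uv; exact: mA.
have [lt|nlt] := boolP (light (c x y) x3).
  exists [:: x3, x2, x1 & s]; split; rewrite /= ?ss //.
    by move=> z; rewrite -sA !inE; case: (z == x1); case: (z == x2); case: (z == x3).
  by rewrite /Q !lE ?lt ?eqxx // eq_sym.
exists [:: x1, x2, x3 & s]; split; rewrite /= ?ss //.
by rewrite /Q !lE // upop nlt orbT.
Qed.

Definition popular_colours := [seq l <- undup [seq c p.1 p.2 | p : T * T] | popular l].

Lemma mem_popular_colours x y : (c x y \in popular_colours) = popular (c x y).
Proof.
rewrite mem_filter mem_undup; case: popular => //=.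
by apply/mapP; exists (x, y); rewrite ?mem_enum.
Qed.

Lemma size_popular_colours : (0 < #|T|)%N -> (size popular_colours)%:R <= eta ^- 2.
Proof.
move=> n0; have nP : 0 < #|T|%:R :> R by rewrite ltr0n.
have upc : uniq popular_colours by rewrite filter_uniq ?undup_uniq.
(* Each pair has only one colour. *)
have le : (\sum_(l <- popular_colours) #|[set p : T * T | c p.1 p.2 == l]| <= #|T| ^ 2)%N.
  rewrite -mulnn -card_prod -sum1_card.
  under eq_bigr do rewrite -sum1dep_card.
  rewrite (exchange_big_dep xpredT) //=; apply: leq_sum => p _.
  rewrite -big_filter sum1_size -[X in (_ <= X)%N]/(size [:: c p.1 p.2]).
  rewrite uniq_leq_size //; first exact: filter_uniq.
  by move=> l; rewrite mem_filter inE eq_sym => /andP[].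
have e2 : 0 < eta ^+ 2 by rewrite exprn_gt0.
have n2 : 0 < #|T|%:R ^+ 2 :> R by rewrite exprn_gt0.
rewrite -[leRHS]div1r ler_pdivlMr // -(ler_pM2r n2) mul1r -mulrA -natrX.
apply: le_trans (_ : _ <= (\sum_(l <- popular_colours)
  #|[set p : T * T | c p.1 p.2 == l]|)%:R) _; last by rewrite ler_nat.
rewrite natr_sum -sum1_size natr_sum big_distrl /= big_seq [leRHS]big_seq.
by apply: ler_sum => l; rewrite mem_filter mul1r natrX => /andP[].
Qed.
End MonochromaticCliques.

Theorem card_mono_cliques_le (R : realType) (r k : nat) (eps : R) :
  (2 < k)%N -> (k <= r)%N -> 0 < eps ->
  exists N : nat, forall (L : eqType) (T : finType) (c : T -> T -> L),
    (forall a : nat -> 'I_3 -> T, ~ mono_multipartite c r.+1 a) ->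
    (N <= #|T|)%N ->
    #|mono_cliques c k|%:R <= 'C(r, k)%:R * (#|T|%:R / r%:R) ^+ k + eps * #|T|%:R ^+ k.
Proof.
case: k => [|[|[|k]]] // _ kr eps0.
(* Zykov's bound loses [k * eta] and the unpopular colours lose [2 * eta]. *)
pose eta : R := Num.min 1 (eps / k.+3.+2%:R).
have eta0 : 0 < eta by rewrite lt_min ltr01 divr_gt0.
have eta1 : eta <= 1 by rewrite ge_min lexx.
have etaE : k.+3%:R * eta + 2 * eta <= eps.
  rewrite -mulrDl -natrD addn2 mulrC -ler_pdivlMr // ge_min lexx orbT //.
pose M := Num.bound (eta ^- 2).
pose delta := eta ^+ (2 ^ r) / r.+1`!%:R.
have fP : 0 < r.+1`!%:R :> R by rewrite ltr0n fact_gt0.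
have d0 : 0 < delta by rewrite divr_gt0 // exprn_gt0.
have [N boxN] := @coloured_box R 3 r.+1 M.+1 _ d0.
exists (maxn 1 N) => L T c nobox; rewrite geq_max => /andP[n1 nN].
pose G := popular_graph c eta; pose pc := popular_colours c eta.
have few : r.+1`!%:R * #|cliques G r.+1|%:R <= eta ^+ (2 ^ r) * #|T|%:R ^+ r.+1.
  rewrite leNgt; apply/negP => many.
  (* There are at most [eta ^- 2] popular colours, whatever the number of points:
     the rank of a colour in their list serves as its bounded name. *)
  pose col x y : 'I_M.+1 := inord (index (c x y) pc).
  have [|a ai aG] := boxN T G col nN.
    rewrite /delta mulrAC ler_pdivrMr // [leRHS]mulrC; exact: ltW.
  apply: (nobox a); split => // i j u v u' v' ij.
  have pcP w z : c (a i w) (a j z) \in pc.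
    by have [/andP[_ pop] _] := aG i j w z w z ij; rewrite mem_popular_colours.
  have colE w z : col (a i w) (a j z) = index (c (a i w) (a j z)) pc :> nat.
    rewrite inordK // ltnS -(ler_nat R) (@le_trans _ _ (size pc)%:R) //.
      by rewrite ler_nat index_size.
    rewrite (le_trans (size_popular_colours _ _ _)) // ltW // archi_boundP //.
    by rewrite invr_ge0 exprn_ge0 // ltW.
  have [_ /(congr1 val) /=] := aG i j u v u' v' ij.
  rewrite !colE => /(congr1 (nth (c (a i u) (a j v)) pc)).
  by rewrite !nth_index.
have := @Zykov_stability R T G r k.+3 eta n1 (leq_trans (ltn0Sn _) kr) kr _ few.
rewrite ltW //= eta1 => /(_ isT) KG.
have unpop := card_mono_unpopular c eta0 k.
have split_card : (#|mono_cliques c k.+3| <= #|cliques G k.+3| +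
    #|[set A in mono_cliques c k.+3 | ~~ clique G A]|)%N.
  rewrite -cardsUI; apply: leq_trans (leq_addr _ _).
  apply/subset_leq_card/fintype.subsetP => A; rewrite !inE => /andP[-> /eqP->].
  by rewrite eqxx andbT /= orbN.
move: split_card; rewrite -(ler_nat R) natrD => /le_trans; apply.
apply: (le_trans (lerD KG unpop)); rewrite -addrA lerD2l -mulrDl.
by rewrite ler_wpM2r // exprn_ge0.
Qed.

(** * Equidistant triples span orthogonal planes *)

Section Geometry.
Variables (R : realType) (d : nat).
Implicit Types u v w x y c : 'rV[R]_d.

Definition dot u v := \sum_(i < d) u 0 i * v 0 i.

Lemma dotC u v : dot u v = dot v u.
Proof. by apply: eq_bigr => i _; rewrite mulrC. Qed.

Lemma dotDl u v w : dot (u + v) w = dot u w + dot v w.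
Proof. by rewrite -big_split; apply: eq_bigr => i _; rewrite mxE mulrDl. Qed.

Lemma dotZl (k : R) u w : dot (k *: u) w = k * dot u w.
Proof. by rewrite /dot mulr_sumr; apply: eq_bigr => i _; rewrite mxE mulrA. Qed.

Lemma dot0l w : dot 0 w = 0.
Proof. by rewrite -(scale0r w) dotZl mul0r. Qed.

Lemma dot_suml (I : finType) (F : I -> 'rV[R]_d) w :
  dot (\sum_i F i) w = \sum_i dot (F i) w.
Proof. by apply: (big_morph (dot^~ w)) => [u v|]; [exact: dotDl|exact: dot0l]. Qed.

Lemma dot_eq0 u : (dot u u == 0) = (u == 0).
Proof.
apply/eqP/eqP => [u0|->]; last exact: dot0l.
have /psumr_eq0P h : dot u u = 0 by [].
apply/rowP => i; rewrite mxE; apply/eqP; rewrite -sqrf_eq0 expr2.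
by rewrite h // => j _; rewrite -expr2 sqr_ge0.
Qed.

Lemma edist_sqr x y : edist x y ^+ 2 = dot (x - y) (x - y).
Proof.
rewrite sqr_sqrtr ?sumr_ge0 // => [|i _]; last exact: sqr_ge0.
by apply: eq_bigr => i _; rewrite !mxE expr2.
Qed.

Lemma edistC x y : edist x y = edist y x.
Proof. by congr Num.sqrt; apply: eq_bigr => i _; rewrite -sqrrN opprB. Qed.

(** The bisecting hyperplane of x and x', seen from x'. *)
Lemma equidistant_dot x x' y : edist x y = edist x' y ->
  2 * dot (x - x') (y - x') = dot (x - x') (x - x').
Proof.
move/(congr1 (fun l => l ^+ 2)); rewrite !edist_sqr => /eqP; rewrite -subr_eq0 => /eqP h.
apply/eqP; rewrite -subr_eq0 -[X in _ == X]oppr0 -{}h big_distrr /=.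
rewrite -!sumrB -sumrN; apply/eqP; apply: eq_bigr => i _; rewrite !mxE; ring.
Qed.

Lemma equidistant_orthogonal x x' y y' :
  edist x y = edist x' y -> edist x y' = edist x' y' -> dot (x - x') (y - y') = 0.
Proof.
move=> /equidistant_dot h /equidistant_dot; rewrite -{}h => h.
have -> : y - y' = (y - x') + -1 *: (y' - x').
  by rewrite scaleN1r opprB addrA subrK.
rewrite dotC dotDl dotZl ![dot _ (x - x')]dotC; lra.
Qed.

(** The points 0, u and w lie on a sphere with centre c, and a line meets a
    sphere in at most two points. *)
Lemma sphere_free u w c (al be : R) : u != 0 -> w != 0 -> u != w ->
  2 * dot u c = dot u u -> 2 * dot w c = dot w w ->
  al *: u + be *: w = 0 -> al = 0 /\ be = 0.
Proof.
move=> u0 w0 uw uc wc /eqP; rewrite addr_eq0 => /eqP auw.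
have [be0|be0] := eqVneq be 0.
  move: auw; rewrite be0 scale0r oppr0 => /eqP; rewrite scaler_eq0 (negbTE u0) orbF.
  by move/eqP.
have [g wE] : exists g : R, w = g *: u.
  by exists (- al / be); rewrite mulrC -scalerA scaleNr auw opprK scalerA mulVf // scale1r.
have uu : dot u u != 0 by rewrite dot_eq0.
have : g * (1 - g) * dot u u = 0.
  by move: wc; rewrite wE !dotZl [dot u (_ *: u)]dotC dotZl; nra.
move/eqP; rewrite !mulf_eq0 (negbTE uu) orbF subr_eq0 => /orP[] /eqP gE.
  by move: w0; rewrite wE gE scale0r eqxx.
by move: uw; rewrite wE -gE scale1r eqxx.
Qed.

(** The two edge vectors at one vertex of each triple give 2 m vectors of R^d, so
    that there is a linear relation between them. Grouping it by triples writes
    0 as a sum of mutually orthogonal vectors; all of these vanish, and then so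
    do the coefficients, by [sphere_free]. *)
Lemma no_equidistant_triples m (a : nat -> 'I_3 -> 'rV[R]_d) :
  (1 < m)%N -> (d < m + m)%N -> ~ mono_multipartite (@edist R d) m a.
Proof.
move=> m1 dm [ai ac].
(* The hypothesis covers only ordered pairs of classes; distances are symmetric. *)
have eq_edist i j s t s' t' : (i < m)%N -> (j < m)%N -> i != j ->
    edist (a i s) (a j t) = edist (a i s') (a j t').
  move=> im jm; rewrite neq_ltn => /orP[ij|ji]; first by apply: ac; rewrite ij.
  by rewrite edistC [RHS]edistC; apply: ac; rewrite ji.
pose s1 : 'I_3 := inord 1; pose s2 : 'I_3 := inord 2.
have s12 : [/\ s1 != 0, s2 != 0 & s1 != s2].
  by split; rewrite -val_eqE /= ?inordK.
pose u (i : nat) := a i s1 - a i 0; pose w (i : nat) := a i s2 - a i 0.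
pose C : 'M[R]_(m + m, d) := col_mx (\matrix_(i < m) u i) (\matrix_(i < m) w i).
have : kermx C != 0.
  rewrite kermx_eq0 -row_leq_rank -ltnNge.
  exact: leq_ltn_trans (rank_leq_col _) dm.
case/rowV0Pn => v /sub_kermxP vC; apply/negP; rewrite negbK.
move: vC; rewrite -[v]hsubmxK mul_row_col.
set al := lsubmx v; set be := rsubmx v => vC.
pose z (i : 'I_m) := al 0 i *: u i + be 0 i *: w i.
have sumz : \sum_i z i = 0.
  rewrite -[RHS]vC big_split /= !mulmx_sum_row.
  by congr (_ + _); apply: eq_bigr => i _; rewrite rowK.
have zz i j : i != j -> dot (z i) (z j) = 0.
  move=> ij; have orth s t : dot (a j s - a j 0) (a i t - a i 0) = 0.
    by apply: equidistant_orthogonal; apply: eq_edist; rewrite // eq_sym.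
  rewrite dotDl !dotZl ![dot _ (z j)]dotC !dotDl !dotZl /u /w.
  by rewrite !orth !(mulr0, addr0).
have z0 i : z i = 0.
  apply/eqP; rewrite -dot_eq0; apply/eqP.
  transitivity (dot (\sum_j z j) (z i)); last by rewrite sumz dot0l.
  by rewrite dot_suml (bigD1 i) //= big1 ?addr0 // => j; exact: zz.
have albe i : al 0 i = 0 /\ be 0 i = 0.
  pose j : nat := if i == 0%N :> nat then 1%N else 0%N.
  have [jm ij] : (j < m)%N /\ (i != j :> nat).
    by rewrite /j; case: eqP => [->|/eqP //]; split => //; exact: ltnW.
  case: s12 => n1 n2 n12; have inj := inj_eq (ai i (ltn_ord i)).
  apply: (@sphere_free (u i) (w i) (a j 0 - a i 0)); last exact: (z0 i).
  - by rewrite subr_eq0 inj.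
  - by rewrite subr_eq0 inj.
  - by rewrite (inj_eq (addIr _)) inj.
  - by apply: equidistant_dot; apply: eq_edist.
  - by apply: equidistant_dot; apply: eq_edist.
have -> : al = 0 by apply/rowP => i; rewrite [RHS]mxE; case: (albe i).
have -> : be = 0 by apply/rowP => i; rewrite [RHS]mxE; case: (albe i).
by rewrite row_mx0.
Qed.
End Geometry.

(** * Simplices as monochromatic cliques of the distance colouring *)

Lemma card_imfset_fin (T : finType) (T' : choiceType) (f : T -> T') (p : {set T}) :
  injective f -> #|` [fset f x | x in p]%fset| = #|p|.
Proof.
move=> fi; rewrite card_imfset // cardE; apply/perm_size/uniq_perm.
- exact: enum_finmem_uniq.
- exact: enum_uniq.
- by move=> x; rewrite enum_finmemE.
Qed.

(** Both bounds use this: for the upper one, [f] is the inclusion of an optimal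
    set of points; for the lower one, it numbers the points of the construction. *)
Lemma nsimplices_imfset (R : realType) (d k : nat) (T : finType) (f : T -> 'rV[R]_d) :
  injective f ->
  nsimplices k [fset f x | x in finset.setT]%fset =
  #|mono_cliques (fun x y => edist (f x) (f y)) k|.
Proof.
move=> fi; pose h (B : {set T}) := [fset f x | x in B]%fset.
have hE B x : (f x \in h B) = (x \in B).
  by apply/imfsetP/idP => [[y yB /fi ->]//|xB]; exists x.
have hi : injective h by move=> B B' BB'; apply/setP => x; rewrite -!hE BB'.
rewrite -(card_imfset_fin _ hi) /nsimplices; congr #|` _|; apply/fsetP => A.
rewrite !inE /= fpowersetE; apply/andP/imfsetP => [[/fsubsetP sA /asboolP[cA [l lA]]]|[B]].
  have AE : A = h [set x | f x \in A].
    apply/fsetP => z; apply/idP/imfsetP => [zA|[x]]; last by rewrite inE => xA ->.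
    by have /imfsetP[x _ zx] := sA _ zA; exists x; rewrite // inE -zx.
  exists [set x | f x \in A] => //=; rewrite inE.
  rewrite -(card_imfset_fin _ fi) -/(h _) -AE cA eqxx andbT.
  apply/monoP => x y z; rewrite !inE => xA yA zA w; rewrite inE => wA xy zw.
  by rewrite !lA // (inj_eq fi).
rewrite inE => /andP[/monoP mB /eqP cB] ->; split.
  by apply/fsubsetP => _ /imfsetP[x _ ->]; apply/imfsetP; exists x; rewrite ?inE.
apply/asboolP; split; first by rewrite card_imfset_fin.
have [/existsP[x /existsP[y /and3P[xB yB xy]]]|no] := boolP [exists x, exists y,
    [&& x \in B, y \in B & x != y]].
  exists (edist (f x) (f y)) => _ _ /imfsetP[z zB ->] /imfsetP[w wB ->].
  by rewrite (inj_eq fi) => zw; apply: mB.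
exists 0 => _ _ /imfsetP[z zB ->] /imfsetP[w wB ->]; rewrite (inj_eq fi) => zw.
by move/existsPn/(_ z)/existsPn/(_ w): no; rewrite zB wB zw.
Qed.

(** * Points on mutually orthogonal circles *)

Section Lenz.
Variables (R : realType) (d r : nat).
Hypotheses (r_gt0 : (0 < r)%N) (r2d : (2 * r <= d)%N).

(** The rational parametrisation of the unit circle provides infinitely many
    points without trigonometry. *)
Definition lenz_x (q : nat) : R := (1 - q%:R ^+ 2) / (1 + q%:R ^+ 2).
Definition lenz_y (q : nat) : R := 2 * q%:R / (1 + q%:R ^+ 2).
Definition lenz (i q : nat) : 'rV[R]_d :=
  \row_j (if j == (2 * i)%N :> nat then lenz_x q
          else if j == (2 * i).+1 :> nat then lenz_y q else 0).

Lemma lenz_den q : 0 < 1 + q%:R ^+ 2 :> R.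
Proof. by rewrite ltr_pwDl // sqr_ge0. Qed.

Lemma lenz_circle q : lenz_x q * lenz_x q + lenz_y q * lenz_y q = 1.
Proof. by rewrite /lenz_x /lenz_y; field; rewrite gt_eqF // lenz_den. Qed.

Lemma dot_lenz_same i q q' : (i < r)%N ->
  dot (lenz i q) (lenz i q') = lenz_x q * lenz_x q' + lenz_y q * lenz_y q'.
Proof.
move=> ir; have lt1 : ((2 * i).+1 < d)%N by lia.
rewrite /dot (bigD1 (Ordinal (ltnW lt1))) // (bigD1 (Ordinal lt1)) /=; last first.
  by rewrite -val_eqE /= gtn_eqF.
rewrite big1 ?addr0 => [|j /andP[/negbTE j0 /negbTE j1]]; last first.
  by move: j0 j1; rewrite -!val_eqE !mxE /= => -> ->; rewrite mul0r.
by rewrite !mxE /= !eqxx gtn_eqF.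
Qed.

Lemma dot_lenz_diff i i' q q' : i != i' -> dot (lenz i q) (lenz i' q') = 0.
Proof.
move=> ii; rewrite /dot big1 // => j _; rewrite !mxE.
by do ![case: eqP => ?]; rewrite ?mulr0 ?mul0r //; move: ii; lia.
Qed.

Lemma lenz_inj i i' q q' : (i < r)%N -> lenz i q = lenz i' q' -> (i, q) = (i', q').
Proof.
move=> ir e; have ii : i = i'.
  apply/eqP; apply: contraT => ii; have := dot_lenz_same q q ir.
  by rewrite {2}e dot_lenz_diff // lenz_circle => /eqP; rewrite eq_sym oner_eq0.
rewrite -{i'}ii in e *; congr pair.
have lt1 : ((2 * i) < d)%N by lia.
have := congr1 (fun M : 'rV_d => M 0 (Ordinal lt1)) e; rewrite !mxE /= eqxx /lenz_x.
move/eqP; rewrite eqr_div ?(gt_eqF (lenz_den _)) // => /eqP qq.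
have : q%:R ^+ 2 = q'%:R ^+ 2 :> R by lra.
by rewrite -!natrX => /eqP; rewrite eqr_nat eqn_exp2r // => /eqP.
Qed.

Lemma edist_lenz i i' q q' : (i < r)%N -> (i' < r)%N -> i != i' ->
  edist (lenz i q) (lenz i' q') = Num.sqrt 2.
Proof.
move=> ir ir' ii; rewrite -[LHS]ger0_norm ?sqrtr_ge0 // -sqrtr_sqr edist_sqr.
have subE x y : dot (x - y) (x - y) = dot x x - 2 * dot x y + dot y y :> R.
  rewrite -scaleN1r !(dotDl, dotZl) ![dot _ (_ + _)]dotC !(dotDl, dotZl) (dotC y x).
  ring.
rewrite subE !dot_lenz_same // !lenz_circle dot_lenz_diff // mulr0 subr0.
by congr Num.sqrt; ring.
Qed.

(** A choice of k circles and of one point on each is a partial function from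
    circles to points with k values. *)
Lemma card_partial_ffun m k :
  #|[set phi : {ffun 'I_r -> option 'I_m} | #|[set i | isSome (phi i)]| == k]| =
  ('C(r, k) * m ^ k)%N.
Proof.
rewrite -sum1dep_card (partition_big (fun phi : {ffun 'I_r -> option 'I_m} =>
   [set i | isSome (phi i)]) (fun S => #|S| == k)) //=.
transitivity (\sum_(S : {set 'I_r} | #|S| == k) m ^ k)%N; last first.
  have -> : 'C(r, k) = #|[set S : {set 'I_r} | #|S| == k]|.
    rewrite -[r in LHS]card_ord -cardsT -cards_draws.
    by apply: eq_card => S; rewrite !inE finset.subsetT.
  by rewrite -sum_nat_const; apply: eq_bigl => S; rewrite inE.
apply: eq_bigr => S /eqP cS.
rewrite sum1dep_card -cS -[X in (_ = X ^ _)%N](_ : #|predC1 (None : option 'I_m)| = m).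
  rewrite -(card_pffun_on None); apply: eq_card => phi; rewrite !inE cS.
  apply/andP/pffun_onP => [[_ /eqP <-]|[/fintype.subsetP sS imS]].
    split; first by apply/fintype.subsetP => i; rewrite !inE; case: (phi i).
    by move=> _ /fintype.imageP[i iS ->]; move: iS; rewrite !inE; case: (phi i).
  have suppE : [set i | isSome (phi i)] = S.
    apply/setP => i; rewrite inE; apply/idP/idP => iS.
      by apply: sS; move: iS; rewrite inE; case: (phi i).
    by have := imS _ (fintype.image_f phi iS); rewrite !inE; case: (phi i).
  by rewrite suppE cS !eqxx.
by rewrite cardC1 card_option card_ord.
Qed.

Lemma lenz_mono_cliques k n :
  ('C(r, k) * (n %/ r) ^ k <=
   #|mono_cliques (fun p q : 'I_n =>
       edist (lenz (p %% r) (p %/ r)) (lenz (q %% r) (q %/ r))) k|)%N.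
Proof.
set m := (n %/ r)%N; rewrite -card_partial_ffun.
(* The point number i + r * q is the q-th one on the i-th circle. *)
have pt_lt (x : 'I_r * 'I_m) : (x.1 + r * x.2 < n)%N.
  have le : (r * m <= n)%N by rewrite mulnC leq_trunc_div.
  by apply: leq_trans le; case: x => -[i ir] [q qm] /=; nia.
pose pt x := Ordinal (pt_lt x).
have pt_mod x : (pt x %% r = x.1)%N by rewrite /= addnC mulnC modnMDl modn_small.
have pt_div x : (pt x %/ r = x.2)%N by rewrite /= addnC mulnC divnMDl // divn_small ?addn0.
have pt_inj : injective pt.
  move=> [i q] [i' q'] e; have := pt_mod (i, q); have := pt_div (i, q).
  by rewrite e pt_mod pt_div => /= /val_inj -> /val_inj ->.
(* The set of the chosen points, as pairs made of a circle and a position. *)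
pose gr (phi : {ffun 'I_r -> option 'I_m}) := [set x : 'I_r * 'I_m | phi x.1 == Some x.2].
have gr_inj : injective gr.
  move=> phi psi /setP e; apply/ffunP => i.
  case E : (phi i) => [q|]; first by have := e (i, q); rewrite !inE /= E eqxx => /esym/eqP.
  case E' : (psi i) => [q|//].
  by have := e (i, q); rewrite !inE /= E E' eqxx.
have card_gr phi : #|gr phi| = #|[set i | isSome (phi i)]|.
  rewrite -(card_in_imset (f := fst) (D := gr phi)) => [|[i q] [i' q']]; last first.
    by rewrite !inE /= => /eqP e /eqP e' ii; move: e'; rewrite -ii e => -[->].
  apply: eq_card => i; rewrite !inE; apply/imsetP/idP => [[[j q]]|].
    by rewrite inE /= => /eqP e ->; rewrite e.
  by case E : (phi i) => [q|//] _; exists (i, q); rewrite // inE E.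
rewrite -(card_imset _ (inj_comp (imset_inj pt_inj) gr_inj)).
apply/subset_leq_card/fintype.subsetP => _ /imsetP[phi /[!inE] cphi ->] /=.
rewrite card_imset // card_gr cphi andbT.
have dE p q : p \in pt @: gr phi -> q \in pt @: gr phi -> p != q ->
    edist (lenz (p %% r) (p %/ r)) (lenz (q %% r) (q %/ r)) = Num.sqrt 2.
  move=> /imsetP[x xg ->] /imsetP[y yg ->]; rewrite (inj_eq pt_inj) => xy.
  rewrite !pt_mod; apply: edist_lenz => //; apply: contraNneq xy => /val_inj xy1.
  move: xg yg; rewrite !inE -xy1 => /eqP-> /eqP[xy2].
  by rewrite [x]surjective_pairing [y]surjective_pairing xy1 xy2.
by apply/monoP => x y z xA yA zA w wA xy zw; rewrite !dE.
Qed.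

Lemma max_nsimplices_ge k n : ('C(r, k) * (n %/ r) ^ k <= max_nsimplices R d k n)%N.
Proof.
pose f (p : 'I_n) := lenz (p %% r) (p %/ r).
have fi : injective f.
  move=> p q /(lenz_inj (ltn_pmod p r_gt0))[e1 e2]; apply: val_inj => /=.
  by rewrite (divn_eq p r) (divn_eq q r) e1 e2.
apply: leq_trans (lenz_mono_cliques k n) _.
rewrite -(nsimplices_imfset k fi) (leq_trans (nsimplices_le_max _ _)) //.
by rewrite card_imfset_fin // cardsT card_ord.
Qed.
End Lenz.

(** * The asymptotics *)

Lemma max_nsimplices_le (R : realType) (d r k : nat) (eps : R) :
  (2 < k)%N -> (k <= r)%N -> (0 < d < 2 * r.+1)%N -> 0 < eps ->
  exists N : nat, forall n, (N <= n)%N ->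
  (max_nsimplices R d k n)%:R <= 'C(r, k)%:R * (n%:R / r%:R) ^+ k + eps * n%:R ^+ k.
Proof.
move=> k3 kr /andP[d0 dr] eps0.
have [N HN] := card_mono_cliques_le k3 kr eps0; exists N => n nN.
have [P [cn <-]] := max_nsimplices_attained R k n d0; rewrite -cn.
have PE : P = [fset val x | x in [set: P]]%fset.
  apply/fsetP => x; apply/idP/imfsetP => [xP|[y _ ->]]; last exact: valP.
  by exists [` xP]%fset; rewrite ?inE.
rewrite {1}PE nsimplices_imfset; last exact: val_inj.
have cP : #|{: P}| = #|` P| by rewrite -cardfE.
rewrite -cP; apply: HN; last by rewrite cP cn.
move=> a [ai ac].
apply: (@no_equidistant_triples _ d r.+1 (fun i s => val (a i s))); [lia|lia|split].
  by move=> i ir; apply: inj_comp val_inj (ai i ir).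
exact: ac.
Qed.

Lemma exprB_le (R : realFieldType) (x y : R) k : 0 <= y -> y <= x -> 
  x ^+ k.+1 - y ^+ k.+1 <= k.+1%:R * (x - y) * x ^+ k.
Proof.
move=> y0 yx; elim: k => [|k IH]; first by rewrite expr0 !expr1 mulr1 mul1r.
have x0 := le_trans y0 yx.
have -> : x ^+ k.+2 - y ^+ k.+2 = x * (x ^+ k.+1 - y ^+ k.+1) + (x - y) * y ^+ k.+1.
  by rewrite !exprS; ring.
have -> : k.+2%:R * (x - y) * x ^+ k.+1 =
    x * (k.+1%:R * (x - y) * x ^+ k) + (x - y) * x ^+ k.+1.
  by rewrite -[k.+2%:R]natr1 exprS; ring.
by rewrite lerD ?ler_wpM2l ?subr_ge0 // lerXn2r ?nnegrE.
Qed.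

Local Open Scope classical_set_scope.
Local Open Scope ring_scope.

Theorem theorem2 (R : realType) (d k r : nat)
    (hk : (6 <= 2 * k)%N) (hd : (2 * k <= d)%N) (hr : r = (d %/ 2)%N) :
  (fun n : nat => (max_nsimplices R d k n)%:R : R) =
  (fun n : nat => 'C(r, k)%:R * (n%:R / r%:R) ^+ k : R)
    +o_\oo (fun n : nat => n%:R ^+ k : R).
Proof.
have k3 : (2 < k)%N by lia.
have kr : (k <= r)%N by lia.
have r0 : (0 < r)%N by lia.
have dr : (0 < d < 2 * r.+1)%N by lia.
have rP : 0 < r%:R :> R by rewrite ltr0n.
apply/eqaddoP => eps eps0.
have [N1 up] := max_nsimplices_le k3 kr dr eps0.
pose N2 := Num.bound ('C(r, k)%:R * k%:R / eps).
exists (maxn 1 (maxn N1 N2)) => // n /=; rewrite !geq_max => /and3P[n1 nN1 nN2].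
have nP : 0 < n%:R :> R by rewrite ltr0n.
rewrite !fctE (ger0_norm (exprn_ge0 k (ltW nP))) ler_norml; apply/andP; split; last first.
  by rewrite lerBlDl up.
rewrite lerBrDl.
have low : ('C(r, k) * (n %/ r) ^ k)%:R <= (max_nsimplices R d k n)%:R :> R.
  by rewrite ler_nat max_nsimplices_ge //; lia.
apply: le_trans low; rewrite natrM natrX.
set x := n%:R / r%:R; set y := (n %/ r)%:R.
have y0 : 0 <= y by [].
have yx : y <= x by rewrite ler_pdivlMr // -natrM ler_nat leq_trunc_div.
have xy1 : x - y <= 1.
  rewrite lerBlDr ler_pdivrMr // -[1 + y]/(1%:R + y) -natrD -natrM ler_nat.
  by rewrite add1n ltnW // ltn_ceil.
have xn : x <= n%:R by rewrite ler_pdivrMr // ler_peMr // ler1n.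
have nN : 'C(r, k)%:R * k%:R <= eps * n%:R.
  rewrite [leRHS]mulrC -ler_pdivrMr // (@le_trans _ _ N2%:R) ?ler_nat //.
  by rewrite ltW // archi_boundP // divr_ge0 ?mulr_ge0 // ltW.
have [k' kE] : exists k', k = k'.+1 by exists k.-1; lia.
rewrite kE in nN *.
have main := exprB_le k' y0 yx.
have : k'.+1%:R * (x - y) * x ^+ k' <= k'.+1%:R * n%:R ^+ k'.
  have x0 := le_trans y0 yx.
  rewrite -mulrA ler_wpM2l // -[leRHS]mul1r ler_pM ?subr_ge0 ?exprn_ge0 //.
  by rewrite lerXn2r // nnegrE.
move=> /(le_trans main) xyk.
have : 'C(r, k'.+1)%:R * (x ^+ k'.+1 - y ^+ k'.+1) <= eps * n%:R ^+ k'.+1.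
  apply: le_trans (_ : 'C(r, k'.+1)%:R * (k'.+1%:R * n%:R ^+ k') <= _).
    exact: ler_wpM2l.
  by rewrite exprS !mulrA ler_wpM2r // exprn_ge0.
by rewrite mulrBr; lra.
Qed.
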